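(* Let $V$ be a vector space (possibly infinite-dimensional) over a field $K$, and let $\{W_i\}_{i \in I}$ be an irredundant linear covering of $V$. Then $\# I \geq \# K + 1$.
   Context: $\# S$ denotes the cardinality of a set $S$; the inequality is between (possibly infinite) cardinal numbers. A linear covering of a $K$-vector space $V$ is a collection $\{W_i\}_{i \in I}$ of proper $K$-linear subspaces of $V$ such that $V = \bigcup_{i \in I} W_i$. It is irredundant if for every proper subset $J \subsetneq I$ one has $\bigcup_{i \in J} W_i \neq V$. *)

(* Defs.v *)
From HB Require Import structures.
From mathcomp Require Import all_boot all_order all_algebra.
From mathcomp Require Import all_classical.

Set Implicit Arguments.
Unset Strict Implicit.
Unset Printing Implicit Defensive.

Import GRing.Theory.

Local Open Scope classical_set_scope.
Local Open Scope ring_scope.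

Definition linear_covering (K : fieldType) (V : lmodType K) (I : Type)
    (W : I -> set V) : Prop :=
  [/\ forall i, submod_closed [in W i],
      forall i, W i `<` [set: V]
    & [set: V] = \bigcup_i W i].

Definition irredundant (K : fieldType) (V : lmodType K) (I : Type)
    (W : I -> set V) : Prop :=
  forall J : set I, J `<` [set: I] -> \bigcup_(i in J) W i <> [set: V].

(* Main.v *)
(* Irredundancy yields a vector [u] that lies in [W i0] and in no other [W i];
   properness yields [v] outside [W i0]. The affine line [v + K u] misses
   [W i0], and meets every other [W i] in at most one point, since two points
   of [W i] on the line would put [u] in [W i]. A cover of the line therefore
   uses [#K] distinct indices, all different from [i0]. *)
Require Import Defs.
From mathcomp Require Import all_boot all_order all_algebra.
From mathcomp Require Import all_classical.

Import GRing.Theory.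

Local Open Scope classical_set_scope.
Local Open Scope card_scope.

Lemma card_leT_injective (T U : Type) (f : T -> U) :
  injective f -> [set: T] #<= [set: U].
Proof.
move=> f_inj; have /injfunPex[g] : exists2 h : T -> U,
  set_fun [set: T] [set: U] h & set_inj [set: T] h.
  by exists f => // x y _ _; apply: f_inj.
exact: inj_card_le g.
Qed.

(** Without the index [i] the family no longer covers [V]. A vector missed by the remaining
    subspaces must lie in [W i], since the full family covers it. *)
Lemma irredundant_private_vector (K : fieldType) (V : lmodType K) (I : Type)
    (W : I -> set V) (i : I) :
  [set: V] = \bigcup_j W j -> irredundant W ->
  exists2 u, W i u & forall j, W j u -> j = i.
Proof.
move=> covW irrW.
have /irrW/eqP/setTPn[u uNW] : [set j | j <> i] `<` [set: I].
  by split=> // /(_ i Logic.I); apply.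
have u_only j : W j u -> j = i.
  by move=> Wju; apply: contrapT => jNi; apply: uNW; exists j.
have [j _ Wju] : (\bigcup_j W j) u by rewrite -covW.
by exists u => //; rewrite -(u_only j Wju).
Qed.

Theorem theorem5 (K : fieldType) (V : lmodType K) (I : Type) (W : I -> set V)
    (covW : linear_covering W) (irrW : irredundant W) :
  [set: (K + unit)%type] #<= [set: I].
Proof.
case: covW => subW properW covW.
have WP i (a : K) x y : W i x -> W i y -> W i (a *: x + y)%R.
  case: (subW i) => _ linW Wx Wy; apply: set_mem.
  by apply: linW; apply: mem_set.
have W_cover x : exists i, W i x.
  by have [i _ Wix] : (\bigcup_i W i) x by [rewrite -covW]; exists i.
(* The zero vector serves only to show that [I] is inhabited. *)
have [i0 _] := W_cover 0%R.
have [u Wu u_only] := irredundant_private_vector K V I W i0 covW irrW.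
have [v vNW] : exists v, ~ W i0 v.
  by case: (properW i0) => _ /existsNP[v] /not_implyP[_ vNW]; exists v.
have /choice[f fP] : forall a : K, exists i, W i (a *: u + v)%R by [].
have f_neq a : f a <> i0.
  (* If [f a = i0], then [v = - a *: u + (a *: u + v)] is a combination of two vectors of [W i0]. *)
  move=> fa; apply: vNW; rewrite -[v](addKr (a *: u)%R) -scaleNr.
  by apply: WP => //; rewrite -fa.
have f_inj : injective f.
  move=> a b fab; apply: contrapT => /eqP; rewrite -subr_eq0 => ab_neq0.
  (* Taking [y = 0] in [WP] gives closure under scaling, used below to divide by [a - b]. *)
  have W0 : W (f a) 0%R by case: (subW (f a)) => /set_mem.
  have Wab : W (f a) ((a - b) *: u)%R.
    have Wb : W (f a) (b *: u + v)%R by rewrite fab.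
    have := WP _ (-1)%R _ _ Wb (fP a).
    by rewrite scaleN1r opprD addrC addrACA subrr addr0 -scalerBl.
  apply: (f_neq a); apply: u_only.
  by have := WP _ (a - b)^-1%R _ _ Wab W0; rewrite addr0 scalerA mulVf // scale1r.
(* The extra point of [unit] goes to [i0], which [f] never hits; this is the [+ 1] of the bound. *)
apply: (card_leT_injective _ _ (fun x => if x is inl a then f a else i0)).
move=> [a|[]] [b|[]] //=; first by move/f_inj->.
  by move/f_neq.
by move/esym/f_neq.
Qed.
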